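(* For all real $a,b>0$, $$m\le\rho\,m\le H\le\rho\,H\le G\le\rho\,G\le L\le\rho\,L\le A\le\rho\,A\le M.$$
   Context: For $a,b>0$: $m=\min\{a,b\}$, $M=\max\{a,b\}$, $A=\frac{a+b}{2}$, $G=\sqrt{ab}$, $H=\frac{2ab}{a+b}$, $L=\frac{a-b}{\log a-\log b}$ if $a\ne b$ and $L=a$ if $a=b$, and $\rho=\sqrt{\dfrac{2A}{A+G}}$. *)

(* Defs.v *)
From Stdlib Require Import Reals.
Open Scope R_scope.

Definition amean (a b : R) : R := (a + b) / 2.

Definition gmean (a b : R) : R := sqrt (a * b).

Definition hmean (a b : R) : R := 2 * a * b / (a + b).

Definition lmean (a b : R) : R :=
  if Req_dec_T a b then a else (a - b) / (ln a - ln b).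

Definition rho (a b : R) : R :=
  sqrt (2 * amean a b / (amean a b + gmean a b)).

(* Main.v *)
Require Import Defs.
From Stdlib Require Import Reals.
From Stdlib Require Import Lra Psatz.
From Coquelicot Require Import Coquelicot.
Open Scope R_scope.

(** The reflection z |-> G^2 / z reverses the order and exchanges m with M and
    H with A, while fixing G.  It therefore turns [rho * A <= M] into
    [rho * m <= H] and [rho * G <= A] into [rho * H <= G], and only the upper
    half of the chain needs an argument of its own.  Since [rho] is at least 1
    exactly because G <= A, what remains is [rho * G <= L], [rho * L <= A] and
    [rho * A <= M]; the inequality [rho * G <= A] follows from the first two.

    The last one is algebraic ([rho_amean_le_max]): as G >= m, its square follows
    from a polynomial inequality between m and M.  The two about L come from
    rational bounds for the logarithm.  By AM-GM,
    rho <= (1 + rho^2) / 2 = (3 A + G) / (2 (A + G)), so it is enough that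
    G (3 A + G) / (2 (A + G)) <= L; in the other direction L <= (A + 2 G) / 3,
    and ((A + 2 G) / 3)^2 <= A (A + G) / 2 = (A / rho)^2 is a quadratic inequality
    true for G <= A.  With t = sqrt (a / b) the two bounds on L become bounds of
    ln t by rational functions of t agreeing with it at t = 1, and comparing
    derivatives reduces each of them to a polynomial with a factor (t - 1)^2. *)

(** * Two rational bounds for the logarithm *)

Lemma nonneg_of_derive_nonneg (f df : R -> R) (t0 t : R) :
  t0 <= t -> f t0 = 0 ->
  (forall s, t0 <= s -> is_derive f s (df s)) ->
  (forall s, t0 <= s -> 0 <= df s) ->
  0 <= f t.
Proof.
intros [lt|<-] f0 Hf Hdf; [|lra].
destruct (MVT_cor2 f df t0 t lt) as [c [Hc [c0 _]]].
  intros s Hs; apply is_derive_Reals, Hf; lra.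
specialize (Hdf c (Rlt_le _ _ c0)); nra.
Qed.

(** The derivative of the difference of the two sides is
    (t - 1)^4 / (t (t^2 + 4 t + 1)^2). *)
Lemma ln_lower_bound (t : R) :
  1 <= t -> 3 * (t * t - 1) / (t * t + 4 * t + 1) <= ln t.
Proof.
intros Ht; apply Rminus_le_0.
apply (nonneg_of_derive_nonneg
  (fun t => ln t - 3 * (t * t - 1) / (t * t + 4 * t + 1))
  (fun t => (t - 1) ^ 4 / (t * (t * t + 4 * t + 1) ^ 2)) 1); trivial.
- rewrite ln_1; lra.
- intros s Hs; auto_derive; [split; [lra|split; [nra|exact I]]|].
  field; split; nra.
- intros s Hs; apply Rdiv_le_0_compat.
    replace ((s - 1) ^ 4) with (((s - 1) ^ 2) ^ 2) by ring; apply pow2_ge_0.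
  apply Rmult_lt_0_compat; [lra|apply pow_lt; nra].
Qed.

(** The derivative of the difference of the two sides has the numerator
    (t - 1)^2 (3 t^4 + t^3 + t + 3). *)
Lemma ln_upper_bound (t : R) :
  1 <= t ->
  ln t <= (t * t - 1) * (t + 1) ^ 2 / (t * (3 * (t * t) + 2 * t + 3)).
Proof.
intros Ht; apply Rminus_le_0.
apply (nonneg_of_derive_nonneg
  (fun t =>
     (t * t - 1) * (t + 1) ^ 2 / (t * (3 * (t * t) + 2 * t + 3)) - ln t)
  (fun t => (t - 1) ^ 2 * (3 * t ^ 4 + t ^ 3 + t + 3) /
            (t * (3 * (t * t) + 2 * t + 3)) ^ 2) 1); trivial.
- rewrite ln_1; lra.
- intros s Hs.
  assert (0 < s * (3 * (s * s) + 2 * s + 3)) by nra.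
  auto_derive; [split; [lra|split; [lra|exact I]]|].
  field; split; nra.
- intros s Hs; apply Rdiv_le_0_compat.
    assert (0 <= s ^ 4) by (apply pow_le; lra).
    assert (0 <= s ^ 3) by (apply pow_le; lra).
    apply Rmult_le_pos; [apply pow2_ge_0|lra].
  apply pow_lt; nra.
Qed.

(** * Elementary properties of the means *)

Lemma amean_pos (a b : R) : 0 < a -> 0 < b -> 0 < amean a b.
Proof. unfold amean; lra. Qed.

Lemma gmean_pos (a b : R) : 0 < a -> 0 < b -> 0 < gmean a b.
Proof. intros; apply sqrt_lt_R0; nra. Qed.

Lemma gmean_sqr (a b : R) :
  0 < a -> 0 < b -> gmean a b * gmean a b = a * b.
Proof. intros; apply sqrt_sqrt; nra. Qed.

Lemma gmean_le_amean (a b : R) :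
  0 < a -> 0 < b -> gmean a b <= amean a b.
Proof.
intros ha hb.
pose proof (gmean_pos a b ha hb); pose proof (amean_pos a b ha hb).
apply Rsqr_incr_0_var; [|lra].
unfold Rsqr; rewrite gmean_sqr by trivial; unfold amean.
pose proof (pow2_ge_0 (a - b)); nra.
Qed.

Lemma hmean_amean (a b : R) :
  0 < a -> 0 < b -> hmean a b = gmean a b * gmean a b / amean a b.
Proof.
intros ha hb; rewrite gmean_sqr by trivial.
unfold hmean, amean; field; lra.
Qed.

Lemma lmean_sym (a b : R) : 0 < a -> 0 < b -> lmean a b = lmean b a.
Proof.
intros ha hb; unfold lmean.
destruct (Req_dec_T a b) as [ab|ab], (Req_dec_T b a) as [ba|ba]; try lra.
assert (ln a <> ln b) by (intros e; apply ab, (ln_inv a b); trivial).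
field; lra.
Qed.

Lemma amean_sym (a b : R) : amean a b = amean b a.
Proof. unfold amean; lra. Qed.

Lemma gmean_sym (a b : R) : gmean a b = gmean b a.
Proof. unfold gmean; now rewrite Rmult_comm. Qed.

(** * Bounds for the logarithmic mean by A and G *)

(** The substitution under which A, G and L are y^2 times functions of t alone. *)
Lemma sqrt_ratio_param (a b : R) :
  0 < b -> b < a ->
  exists t y, 1 < t /\ 0 < y /\ a = t * y * (t * y) /\ b = y * y.
Proof.
intros hb hab; exists (sqrt (a / b)), (sqrt b).
assert (1 < a / b) by (apply Rlt_div_r; lra).
repeat split.
- rewrite <- sqrt_1; apply sqrt_lt_1; lra.
- now apply sqrt_lt_R0.
- replace (sqrt (a / b) * sqrt b * (sqrt (a / b) * sqrt b))
    with ((sqrt (a / b) * sqrt (a / b)) * (sqrt b * sqrt b)) by ring.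
  rewrite !sqrt_sqrt by lra; field; lra.
- now rewrite sqrt_sqrt by lra.
Qed.

Lemma gmean_param (t y : R) :
  0 < t -> 0 < y -> gmean (t * y * (t * y)) (y * y) = t * (y * y).
Proof.
intros; unfold gmean.
replace (t * y * (t * y) * (y * y)) with ((t * (y * y)) * (t * (y * y)))
  by ring.
apply sqrt_square; nra.
Qed.

Lemma lmean_param (t y : R) :
  1 < t -> 0 < y ->
  lmean (t * y * (t * y)) (y * y) = (t * t - 1) * (y * y) / (2 * ln t).
Proof.
intros Ht Hy; unfold lmean.
assert (0 < ln t) by (rewrite <- ln_1; apply ln_increasing; lra).
destruct (Req_dec_T _ _) as [e|_].
  assert (0 < (t * t - 1) * (y * y)) by (apply Rmult_lt_0_compat; nra); lra.
rewrite !ln_mult by nra; field; lra.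
Qed.

Lemma lmean_diag (a : R) : lmean a a = a.
Proof. unfold lmean; destruct (Req_dec_T a a); lra. Qed.

Lemma gmean_diag (a : R) : 0 < a -> gmean a a = a.
Proof. intros; apply sqrt_square; lra. Qed.

Lemma amean_diag (a : R) : amean a a = a.
Proof. unfold amean; lra. Qed.

Lemma lmean_upper_bound (a b : R) :
  0 < a -> 0 < b -> lmean a b <= (amean a b + 2 * gmean a b) / 3.
Proof.
assert (W : forall a b, 0 < b -> b < a ->
          lmean a b <= (amean a b + 2 * gmean a b) / 3).
  clear a b; intros a b hb hab.
  destruct (sqrt_ratio_param a b hb hab) as (t & y & Ht & Hy & -> & ->).
  rewrite lmean_param, gmean_param by lra; unfold amean.
  assert (0 < ln t) by (rewrite <- ln_1; apply ln_increasing; lra).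
  pose proof (ln_lower_bound t (Rlt_le _ _ Ht)) as Hln.
  apply Rle_div_l in Hln; [|nra].
  apply Rle_div_l; [lra|].
  assert (0 < y * y) by nra; nra.
intros ha hb; destruct (Rtotal_order a b) as [ab|[<-|ab]].
- rewrite lmean_sym, amean_sym, gmean_sym by trivial; now apply W.
- rewrite lmean_diag, amean_diag, gmean_diag by trivial; lra.
- now apply W.
Qed.

Lemma lmean_lower_bound (a b : R) :
  0 < a -> 0 < b ->
  gmean a b * (3 * amean a b + gmean a b) / (2 * (amean a b + gmean a b))
    <= lmean a b.
Proof.
assert (W : forall a b, 0 < b -> b < a ->
  gmean a b * (3 * amean a b + gmean a b) / (2 * (amean a b + gmean a b))
    <= lmean a b).
  clear a b; intros a b hb hab.
  destruct (sqrt_ratio_param a b hb hab) as (t & y & Ht & Hy & -> & ->).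
  rewrite lmean_param, gmean_param by lra; unfold amean.
  assert (0 < ln t) by (rewrite <- ln_1; apply ln_increasing; lra).
  pose proof (ln_upper_bound t (Rlt_le _ _ Ht)) as Hln.
  apply Rle_div_r in Hln; [|nra].
  assert (0 < y * y) by nra.
  apply (proj1 (Rle_div_r _ _ (2 * ln t) ltac:(lra))).
  replace (t * (y * y) * (3 * ((t * y * (t * y) + y * y) / 2) + t * (y * y)) /
           (2 * ((t * y * (t * y) + y * y) / 2 + t * (y * y))) * (2 * ln t))
    with (ln t * (t * (3 * (t * t) + 2 * t + 3)) * (y * y) / (t + 1) ^ 2)
    by (field; repeat split; nra).
  apply Rle_div_l; [apply pow_lt; lra|].
  apply (Rmult_le_compat_r (y * y)) in Hln; lra.
intros ha hb; destruct (Rtotal_order a b) as [ab|[<-|ab]].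
- rewrite lmean_sym, amean_sym, gmean_sym by trivial; now apply W.
- rewrite lmean_diag, amean_diag, gmean_diag by trivial.
  right; field; lra.
- now apply W.
Qed.

(** * The factor rho *)

Lemma rho_sqr (a b : R) :
  0 < a -> 0 < b ->
  rho a b * rho a b = 2 * amean a b / (amean a b + gmean a b).
Proof.
intros ha hb; apply sqrt_sqrt.
pose proof (amean_pos a b ha hb); pose proof (gmean_pos a b ha hb).
apply Rdiv_le_0_compat; lra.
Qed.

Lemma rho_ge_1 (a b : R) : 0 < a -> 0 < b -> 1 <= rho a b.
Proof.
intros ha hb; rewrite <- sqrt_1; apply sqrt_le_1_alt.
pose proof (gmean_pos a b ha hb); pose proof (gmean_le_amean a b ha hb).
apply Rle_div_r; lra.
Qed.

(** Squaring removes the root in [rho], so that a bound on it becomes a polynomial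
    inequality in A and G. *)
Lemma rho_mul_le (a b u v : R) :
  0 < a -> 0 < b -> 0 <= v ->
  2 * amean a b * (u * u) <= v * v * (amean a b + gmean a b) ->
  rho a b * u <= v.
Proof.
intros ha hb hv h.
pose proof (amean_pos a b ha hb); pose proof (gmean_pos a b ha hb).
apply Rsqr_incr_0_var; trivial; unfold Rsqr.
replace (rho a b * u * (rho a b * u)) with ((rho a b * rho a b) * (u * u))
  by ring.
rewrite rho_sqr by trivial.
replace (2 * amean a b / (amean a b + gmean a b) * (u * u))
  with (2 * amean a b * (u * u) / (amean a b + gmean a b)) by (field; lra).
apply Rle_div_l; lra.
Qed.

Lemma rho_gmean_le_lmean (a b : R) :
  0 < a -> 0 < b -> rho a b * gmean a b <= lmean a b.
Proof.
intros ha hb; eapply Rle_trans; [|now apply lmean_lower_bound].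
pose proof (amean_pos a b ha hb); pose proof (gmean_pos a b ha hb).
(* AM-GM for 1 and rho^2. *)
assert (Hr : rho a b <= (1 + rho a b * rho a b) / 2)
  by (pose proof (pow2_ge_0 (rho a b - 1)); lra).
rewrite (rho_sqr a b) in Hr by trivial.
replace (gmean a b * (3 * amean a b + gmean a b) /
         (2 * (amean a b + gmean a b)))
  with ((1 + 2 * amean a b / (amean a b + gmean a b)) / 2 * gmean a b)
  by (field; lra).
apply Rmult_le_compat_r; lra.
Qed.

Lemma rho_lmean_le_amean (a b : R) :
  0 < a -> 0 < b -> rho a b * lmean a b <= amean a b.
Proof.
intros ha hb.
pose proof (amean_pos a b ha hb); pose proof (gmean_pos a b ha hb).
pose proof (gmean_le_amean a b ha hb); pose proof (rho_ge_1 a b ha hb).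
apply Rle_trans with (rho a b * ((amean a b + 2 * gmean a b) / 3)).
  apply Rmult_le_compat_l; [lra|now apply lmean_upper_bound].
apply rho_mul_le; [trivial|trivial|lra|].
set (A := amean a b) in *; set (G := gmean a b) in *.
(* 9 A (A + G) - 2 (A + 2 G)^2 factors as (A - G) (7 A + 8 G). *)
assert (0 <= A * ((A - G) * (7 * A + 8 * G)))
  by (apply Rmult_le_pos; [lra|apply Rmult_le_pos; lra]).
nra.
Qed.

Lemma min_le_gmean (a b : R) : 0 < a -> 0 < b -> Rmin a b <= gmean a b.
Proof.
intros ha hb; pose proof (gmean_pos a b ha hb).
apply Rsqr_incr_0_var; [|lra]; unfold Rsqr.
rewrite gmean_sqr by trivial.
unfold Rmin; destruct (Rle_dec a b); nra.
Qed.

(** With d = (M - m) / 2, replacing G by m leaves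
    M^2 (A + m) - 2 A^3 = d (3 A^2 - d^2), which is nonnegative as d <= A. *)
Lemma rho_amean_le_max (a b : R) :
  0 < a -> 0 < b -> rho a b * amean a b <= Rmax a b.
Proof.
intros ha hb; pose proof (min_le_gmean a b ha hb) as HmG.
apply rho_mul_le; trivial.
  apply Rle_trans with a; [lra|apply Rmax_l].
apply Rle_trans with (Rmax a b * Rmax a b * (amean a b + Rmin a b));
  [|apply Rmult_le_compat_l; [|lra]; apply Rle_0_sqr].
assert (P : forall m M, 0 < m -> m <= M ->
          2 * ((m + M) / 2) * ((m + M) / 2 * ((m + M) / 2))
            <= M * M * ((m + M) / 2 + m)).
  intros m M hm hM.
  assert (0 <= (M - m) * (3 * (m + M) ^ 2 - (M - m) ^ 2))
    by (apply Rmult_le_pos; nra).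
  nra.
unfold amean, Rmin, Rmax; destruct (Rle_dec a b).
- now apply P.
- rewrite (Rplus_comm a b); apply P; lra.
Qed.

(** * The chain *)

(** With g = G, carries each inequality of the upper half of the chain to its
    mirror image in the lower half. *)
Lemma reflect_mul_le (r g z w : R) :
  0 < z -> 0 < w -> r * z <= w -> r * (g * g / w) <= g * g / z.
Proof.
intros hz hw h.
replace (r * (g * g / w)) with (r * z * (g * g / (z * w))) by (field; lra).
replace (g * g / z) with (w * (g * g / (z * w))) by (field; lra).
apply Rmult_le_compat_r; trivial.
apply Rdiv_le_0_compat; [apply Rle_0_sqr|nra].
Qed.

Theorem theorem4p2 (a b : R) (ha : 0 < a) (hb : 0 < b) :
  let m := Rmin a b in
  let M := Rmax a b in
  let A := amean a b in
  let G := gmean a b in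
  let H := hmean a b in
  let L := lmean a b in
  let r := rho a b in
  m <= r * m /\ r * m <= H /\
  H <= r * H /\ r * H <= G /\
  G <= r * G /\ r * G <= L /\
  L <= r * L /\ r * L <= A /\
  A <= r * A /\ r * A <= M.
Proof.
intros m M A G H L r.
assert (HA : 0 < A) by now apply amean_pos.
assert (HG : 0 < G) by now apply gmean_pos.
assert (Hr : 1 <= r) by now apply rho_ge_1.
assert (Hm : 0 < m) by now apply Rmin_pos.
assert (HM : 0 < M) by (apply Rlt_le_trans with a; [lra|apply Rmax_l]).
assert (HGL : r * G <= L) by now apply rho_gmean_le_lmean.
assert (HLA : r * L <= A) by now apply rho_lmean_le_amean.
assert (HAM : r * A <= M) by now apply rho_amean_le_max.
assert (HL : 0 < L) by nra.
assert (HGA : r * G <= A) by nra.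
assert (EH : H = G * G / A) by now apply hmean_amean.
assert (Em : m = G * G / M).
  unfold G; rewrite gmean_sqr by trivial.
  apply Rmult_eq_reg_r with M; [|lra].
  unfold m, M, Rmin, Rmax in *; destruct (Rle_dec a b); field; lra.
assert (HH : 0 < H) by (rewrite EH; apply Rdiv_lt_0_compat; nra).
assert (HmH : r * m <= H)
  by (rewrite EH, Em; now apply reflect_mul_le).
assert (HHG : r * H <= G).
  replace G with (G * G / G) by (field; lra).
  rewrite EH; now apply reflect_mul_le.
repeat split; trivial; nra.
Qed.
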